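(* Let $M$ be a manifold, let $\Xi=\Xi(\mathbf{x},\mathbf{x}^* )$ be a dissipation potential on $T^*M$, and let $S$ be a real-valued function on $M$ (the entropy). Let $X_\Xi$ be the Hamiltonian vector field on $T^*M$ generated by the Hamiltonian function $\Xi$, and let $X_\Xi^{dS} := T\pi_M\circ X_\Xi\circ dS$ be the projected (gradient) vector field on $M$. Then the Hamiltonian dynamics $X_\Xi$ and the gradient dynamics $X_\Xi^{dS}$ are compatible in the sense that $$T(dS)\circ X_\Xi^{dS} = X_\Xi\circ dS$$ if and only if the entropy is a solution of the Hamilton-Jacobi equation $$\Xi\big|_{\mathbf{x}^*=S_{\mathbf{x}}} = \epsilon$$ for a constant $\epsilon$.
   Context: All objects are smooth. Let $(\mathbf{x},\mathbf{x}^* )$ be Darboux coordinates on $T^*M$ and $\pi_M:T^*M\to M$ the projection. The Hamiltonian vector field of a function $H$ on $T^*M$ with respect to the canonical symplectic form $\Omega_M=d\mathbf{x}\wedge d\mathbf{x}^*$ is defined by $\iota_{X_H}\Omega_M=dH$, i.e. $X_H = H_{\mathbf{x}^*}\cdot\nabla_{\mathbf{x}} - H_{\mathbf{x}}\cdot\nabla_{\mathbf{x}^*}$. Subscripts denote partial derivatives. A dissipation potential is a real-valued function $\Xi$ on $T^*M$ such that: $\Xi(\mathbf{x},0)=0$ for all $\mathbf{x}$; $\Xi$ reaches its minimum at $\mathbf{x}^*=0$; and $\Xi$ is a convex function of $\mathbf{x}^*$ in a neighborhood of $\mathbf{x}^*=0$ for all $\mathbf{x}$. The exterior derivative $dS$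 is viewed as the section $M\to T^*M$, $\mathbf{x}\mapsto(\mathbf{x},S_{\mathbf{x}})$, and $T(dS):TM\to TT^*M$ is its tangent map. In coordinates $X_\Xi^{dS} = \Xi_{\mathbf{x}^*}|_{\mathbf{x}^*=S_{\mathbf{x}}}\cdot\nabla_{\mathbf{x}}$, i.e. the gradient dynamics $\dot{\mathbf{x}} = \Xi_{\mathbf{x}^*}|_{\mathbf{x}^*=S_{\mathbf{x}}}$.
   Formalization: The manifold M is assumed connected; on a disconnected manifold compatibility only forces Ξ restricted to x*=S_x to be locally constant, so a single constant ε need not exist. *)

(* Defs.v *)
From HB Require Import structures.
From mathcomp Require Import all_boot all_order all_algebra.
From mathcomp Require Import all_classical all_reals all_analysis.

Set Implicit Arguments.
Unset Strict Implicit.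
Unset Printing Implicit Defensive.

Import Order.TTheory GRing.Theory Num.Theory.
Import numFieldNormedType.Exports.

Local Open Scope classical_set_scope.
Local Open Scope ring_scope.

Section CalculusInRn.
Context {R : realType}.

(* [C_on k U f]: f is of class C^k on U.  Only used for open U: the
   derivatives are those of the total function f, and at a point of an open U
   they do not depend on the values of f outside U. *)
Fixpoint C_on (n : nat) (W : normedModType R) (k : nat)
    (U : set 'rV[R]_n) (f : 'rV[R]_n -> W) : Prop :=
  match k with
  | 0%N => forall x, U x -> {for x, continuous f}
  | k'.+1 => (forall x, U x -> differentiable f x) /\
             (forall v : 'rV[R]_n, C_on k' U (fun x => 'D_v f x))
  end.

Definition smooth_on (n : nat) (W : normedModType R)
    (U : set 'rV[R]_n) (f : 'rV[R]_n -> W) : Prop :=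
  forall k, C_on k U f.

End CalculusInRn.

(* A partial bijection from [dom] onto [chart_map @` dom]; the values of
   [chart_map] outside [dom] and of [chart_inv] outside the image are junk. *)
Record chart (R : realType) (n : nat) (X : Type) := Chart {
  dom : set X;
  chart_map : X -> 'rV[R]_n;
  chart_inv : 'rV[R]_n -> X }.

Definition chart_image {R : realType} {n : nat} {X : Type} (c : chart R n X) :
  set 'rV[R]_n := chart_map c @` dom c.

(* The data on which smoothness, tangent vectors and tangent maps depend: an
   atlas, and for each point x one chart of the atlas around x, in which
   tangent vectors and covectors at x are written. *)
Record charted_space (R : realType) (n : nat) := ChartedSpace {
  point :> Type;
  atlas : set (chart R n point);
  chart_at : point -> chart R n point }.

Record smooth_manifold (R : realType) (n : nat) := SmoothManifold {
  mfd_space : topologicalType;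
  mfd_atlas : set (chart R n mfd_space);
  mfd_chart_at : mfd_space -> chart R n mfd_space;
  mfd_chart_at_atlas : forall x, mfd_atlas (mfd_chart_at x);
  mfd_chart_at_dom : forall x, dom (mfd_chart_at x) x;
  mfd_dom_open : forall c, mfd_atlas c -> open (dom c);
  mfd_image_open : forall c, mfd_atlas c -> open (chart_image c);
  mfd_chartK : forall c, mfd_atlas c ->
    forall x, dom c x -> chart_inv c (chart_map c x) = x;
  mfd_map_continuous : forall c, mfd_atlas c ->
    forall x, dom c x -> {for x, continuous (chart_map c)};
  mfd_inv_continuous : forall c, mfd_atlas c ->
    forall y, chart_image c y -> {for y, continuous (chart_inv c)};
  mfd_transition_smooth : forall c c', mfd_atlas c -> mfd_atlas c' ->
    smooth_on (chart_map c @` (dom c `&` dom c'))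
              (chart_map c' \o chart_inv c);
  mfd_hausdorff : hausdorff_space mfd_space;
  mfd_second_countable : @second_countable mfd_space }.

Definition mfd_charted (R : realType) (n : nat) (M : smooth_manifold R n) :
  charted_space R n := ChartedSpace (@mfd_atlas R n M) (@mfd_chart_at R n M).
Coercion mfd_charted : smooth_manifold >-> charted_space.

Section Tangent.
Context {R : realType}.

Definition smooth_function (n : nat) (X : charted_space R n) (f : X -> R) :
    Prop :=
  forall c, atlas c -> smooth_on (chart_image c) (f \o chart_inv c : _ -> R^o).

(* TX as a set.  A tangent vector at x is represented by its components in
   [chart_at x], so a pair (x, v) is the vector \sum_j v_j d/dx^j at x, where
   x^j are the coordinates of [chart_at x].  As [chart_at] varies with x, this
   is not a global trivialisation of the bundle. *)
Definition tangent_bundle (n : nat) (X : charted_space R n) : Type :=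
  (X * 'rV[R]_n)%type.

Definition tangent_map (m n : nat) (X : charted_space R m)
    (Y : charted_space R n) (F : X -> Y) (w : tangent_bundle X) :
    tangent_bundle Y :=
  let c := chart_at w.1 in
  (F w.1,
   'd (chart_map (chart_at (F w.1)) \o F \o chart_inv c)
      (chart_map c w.1) w.2).

Definition differential (n : nat) (X : charted_space R n) (f : X -> R)
    (w : tangent_bundle X) : R :=
  let c := chart_at w.1 in
  'd (f \o chart_inv c : _ -> R^o) (chart_map c w.1) w.2.

Definition vector_field (n : nat) (X : charted_space R n)
    (V : X -> tangent_bundle X) : Prop :=
  forall x, (V x).1 = x.

End Tangent.

Section Cotangent.
Context {R : realType} {n : nat}.

Definition dotrow (u v : 'rV[R]_n) : R := \sum_j u 0 j * v 0 j.

(* (x, p) is the covector \sum_j p_j dx^j at x, in the coordinates x^j of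
   [chart_at x]. *)
Definition cotangent_point (M : charted_space R n) : Type :=
  (M * 'rV[R]_n)%type.

(* The Darboux chart (x, x^* ) of T^*M induced by the chart c of M: the
   components of the covector are converted from [chart_at x] to c by the
   transposed Jacobian of the change of coordinates. *)
Definition cotangent_chart (M : charted_space R n) (c : chart R n M) :
    chart R (n + n) (cotangent_point M) :=
  Chart [set z : cotangent_point M | dom c z.1]
    (fun z => let d := chart_at z.1 in
       row_mx (chart_map c z.1)
         (z.2 *m (jacobian (chart_map d \o chart_inv c) (chart_map c z.1))^T))
    (fun y => let x := chart_inv c (lsubmx y) in let d := chart_at x in
       (x, rsubmx y *m
           (jacobian (chart_map c \o chart_inv d) (chart_map d x))^T)).

Definition cotangent_bundle (M : charted_space R n) : charted_space R (n + n) :=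
  @ChartedSpace R (n + n) (cotangent_point M)
    [set C | exists2 c, atlas c & C = cotangent_chart c]
    (fun z => cotangent_chart (chart_at z.1)).

Definition cotangent_proj (M : charted_space R n) (z : cotangent_bundle M) :
  M := z.1.

Definition d_section (M : charted_space R n) (S : M -> R) (x : M) :
    cotangent_bundle M :=
  (x, \row_j @differential R n M S (x, delta_mx 0 j)).

(* Omega_M = dx /\ dx^*; a and b are tangent vectors to T^*M at the same point
   z, written in the Darboux chart at z. *)
Definition canonical_form (M : charted_space R n) (z : cotangent_bundle M)
    (a b : 'rV[R]_(n + n)) : R :=
  dotrow (lsubmx a) (rsubmx b) - dotrow (lsubmx b) (rsubmx a).

Definition hamiltonian_vector_field (M : charted_space R n)
    (H : cotangent_bundle M -> R)
    (V : cotangent_bundle M -> tangent_bundle (cotangent_bundle M)) : Prop :=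
  vector_field V /\
  forall (z : cotangent_bundle M) (b : 'rV[R]_(n + n)),
    canonical_form z (V z).2 b =
    @differential R (n + n) (cotangent_bundle M) H (z, b).

(* X_H = H_{x^*} . nabla_x - H_x . nabla_{x^*}; in particular the Hamiltonian
   vector field exists and is unique. *)
Lemma hamiltonian_vector_fieldP (M : charted_space R n)
    (H : cotangent_bundle M -> R)
    (V : cotangent_bundle M -> tangent_bundle (cotangent_bundle M)) :
  hamiltonian_vector_field H V <->
  forall z : cotangent_bundle M,
    let dH b := @differential R (n + n) (cotangent_bundle M) H (z, b) in
    V z = (z, row_mx (\row_j dH (delta_mx 0 (rshift n j)))
                     (- \row_j dH (delta_mx 0 (lshift n j)))).
Proof.
have dotD (u : 'rV[R]_n) j : dotrow u (delta_mx 0 j) = u 0 j.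
  rewrite /dotrow (bigD1 j) //= big1 ?addr0; first by rewrite mxE !eqxx mulr1.
  by move=> i /negbTE ij; rewrite mxE ij mulr0.
have dotC (u v : 'rV[R]_n) : dotrow u v = dotrow v u.
  by apply: eq_bigr => i _; rewrite mulrC.
have dot0 (u : 'rV[R]_n) : dotrow u 0 = 0.
  by rewrite /dotrow big1 // => i _; rewrite mxE mulr0.
have lE j : delta_mx 0 (lshift n j) = row_mx (delta_mx 0 j) 0 :> 'rV[R]_(n + n).
  apply/rowP => k; case: (split_ordP k) => i ->.
    by rewrite row_mxEl !mxE /= (inj_eq (@lshift_inj _ _)).
  by rewrite row_mxEr !mxE /= eq_rlshift.
have rE j : delta_mx 0 (rshift n j) = row_mx 0 (delta_mx 0 j) :> 'rV[R]_(n + n).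
  apply/rowP => k; case: (split_ordP k) => i ->.
    by rewrite row_mxEl !mxE /= eq_lrshift.
  by rewrite row_mxEr !mxE /= (inj_eq (@rshift_inj _ _)).
split=> [[VE VH] z dH|VE].
  rewrite [LHS]surjective_pairing VE; congr pair; rewrite -[LHS]hsubmxK.
  congr row_mx; apply/rowP => j; rewrite [RHS]mxE.
    rewrite mxE /dH -VH rE /canonical_form row_mxKl row_mxKr dotD.
    by rewrite [dotrow 0 _]dotC dot0 subr0 !mxE.
  rewrite [X in - X]mxE /dH -VH lE /canonical_form row_mxKl row_mxKr dot0 sub0r.
  by rewrite opprK [RHS]dotC dotD !mxE.
split=> [z|z b]; rewrite VE //= /canonical_form row_mxKl row_mxKr.
have linE (f : {linear 'rV[R]_(n + n) -> R^o}) : f b =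
    dotrow (\row_j f (delta_mx 0 (rshift n j))) (rsubmx b) +
    dotrow (lsubmx b) (\row_j f (delta_mx 0 (lshift n j))).
  rewrite [in LHS](row_sum_delta b) linear_sum big_split_ord /= addrC.
  congr (_ + _); apply: eq_bigr => j _; rewrite linearZ !mxE //=.
  exact: mulrC.
rewrite /differential /= linE; congr (_ + _).
by rewrite /dotrow -sumrN; apply: eq_bigr => j _; rewrite !mxE mulrN opprK.
Qed.

Definition dissipation_potential (M : charted_space R n)
    (Xi : cotangent_bundle M -> R) : Prop :=
  [/\ smooth_function Xi,
      (forall x : M, Xi (x, 0) = 0),
      (forall (x : M) (p : 'rV[R]_n), Xi (x, 0) <= Xi (x, p)) &
      (forall x : M, exists U : set 'rV[R]_n,
         [/\ nbhs (0 : 'rV[R]_n) U, convex_set U &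
             convex_function U (fun p => Xi (x, p))])].

Definition projected_vector_field (M : charted_space R n) (S : M -> R)
    (V : cotangent_bundle M -> tangent_bundle (cotangent_bundle M)) :
    M -> tangent_bundle M :=
  tangent_map (@cotangent_proj M) \o V \o d_section S.

End Cotangent.

(* Main.v *)
Require Import Defs.
From mathcomp Require Import all_boot all_order all_algebra.
From mathcomp Require Import all_classical all_reals all_analysis.
From mathcomp Require Import ring lra.

Import Order.TTheory GRing.Theory Num.Theory.
Import numFieldNormedType.Exports.

Local Open Scope classical_set_scope.
Local Open Scope ring_scope.

(* Around x, in the chart c of M used at x and the Darboux chart it induces,
   put s = S o c^-1 and let H be the Hessian matrix of s, a = Xi_{x^*} and
   b = Xi_x, all at x.  The section dS reads y |-> (y, grad s y), so the two
   sides of the compatibility condition at x are (a, a H) and (a, -b).  On the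
   other hand the restriction Xi o dS has differential
   u |-> u . (b + a H^T), and H is symmetric.  Hence compatibility at x says
   that d(Xi o dS) vanishes at x, and on the connected manifold M this holds
   everywhere if and only if Xi o dS is constant. *)

(** * Differentials of maps that agree near a point, and of maps into row vectors *)

(** The first-order expansion of [f] at [x] is also one of [g], and the linear part of such an
    expansion is unique. This is what allows a map read in charts to be replaced by a formula that
    holds only near the point, the charts being junk farther away. *)
Lemma near_eq_diff {R : realFieldType} {V W : normedModType R} (f g : V -> W)
    (x : V) :
  {near x, f =1 g} -> differentiable f x ->
  differentiable g x /\ ('d g x = 'd f x :> (V -> W)).
Proof.
move=> fg df; have fgx : f x = g x := nbhs_singleton fg.
have Eg : g \o shift x = cst (g x) + 'd f x +o_ 0 id.
  apply/eqaddoP => e e0.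
  have /eqaddoP/(_ e e0) := diff_locally df; rewrite fgx.
  apply: filter_app; near=> h => /=.
  suff -> : (g \o shift x - (cst (g x) + 'd f x)) h =
    (f \o shift x - (cst (g x) + 'd f x)) h by [].
  rewrite !fctE /=; congr (_ - _); symmetry.
  near: h; move: fg; rewrite (near_shift 0 x) subr0; apply: filterS => h /=.
  by rewrite addrC.
have dg : 'd g x = 'd f x :> (V -> W).
  by apply: diff_unique => //; exact: diff_continuous.
split=> //; apply/diff_locallyP; rewrite dg; split=> //.
exact: diff_continuous.
Unshelve. all: by end_near. Qed.

Lemma differentiable_rV {R : realFieldType} {V : normedModType R} {n : nat}
    (f : V -> 'rV[R]_n) (x : V) :
  (forall j, differentiable (fun y => f y 0 j : R^o) x) -> differentiable f x.
Proof.
move=> df; have -> : f = \sum_(j < n) (fun y => f y 0 j *: delta_mx 0 j).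
  by apply/funext => y; rewrite fct_sumE [LHS]row_sum_delta.
by apply: differentiable_sum => j; exact: differentiableZl.
Qed.

Lemma diff_rV {R : realFieldType} {V : normedModType R} {n : nat}
    (f : V -> 'rV[R]_n) (x u : V) :
  differentiable f x ->
  'd f x u = \row_j 'd (fun y => f y 0 j : R^o) x u.
Proof.
move=> df; have dj j : differentiable (fun y => f y 0 j : R^o) x.
  exact: (differentiable_comp df (differentiable_coord _ _ _)).
rewrite -deriveE// derive_mx; last exact: diff_derivable.
by apply/rowP => j; rewrite !mxE deriveE.
Qed.

(** * Symmetry of second derivatives *)

Section SecondDerivative.
Context {R : realType} {V : normedModType R}.
Implicit Types (s : V -> R^o) (y u v : V).

(* The mixed second difference of s over the parallelogram t u, t v is
   t^2 D_v D_u s + o(t^2); it is symmetric in u and v. *)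
Lemma second_difference s y u v :
  (\forall z \near y, differentiable s z) ->
  differentiable (fun z => 'D_u s z) y ->
  forall e, 0 < e -> \forall t \near 0^'+,
    `|s (y + t *: u + t *: v) - s (y + t *: u) - s (y + t *: v) + s y
      - t ^+ 2 * 'd (fun z => 'D_u s z) y v| <= e * t ^+ 2.
Proof.
move=> ds dg e e0; set g := fun z => 'D_u s z.
(* The expansion of [g] is used at [c *: u + t *: v] and at [c *: u] with [0 <= c <= t], whose norms
   add up to at most [t * (2 * |u| + |v|)]. The summand [1] keeps [K] positive when [u] and [v]
   vanish. *)
pose K := 2 * `|u| + `|v| + 1.
have K0 : 0 < K by rewrite /K; have := normr_ge0 u; have := normr_ge0 v; lra.
have eK0 : 0 < e / K by rewrite divr_gt0.
have /eqaddoP/(_ _ eK0)/nbhs_ballP[r1 /= r10 gr1] := diff_locally dg.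
have /nbhs_ballP[r2 /= r20 sr2] := ds.
have gB h : `|h| < r1 -> `|g (y + h) - g y - 'd g y h| <= e / K * `|h|.
  move=> hr; have := gr1 h; rewrite -ball_normE /= sub0r normrN => /(_ hr).
  by rewrite !fctE /= opprD addrA (addrC h).
have sB h : `|h| < r2 -> differentiable s (y + h).
  move=> hr; apply: sr2; rewrite -ball_normE /= opprD addrA subrr sub0r.
  by rewrite normrN.
near=> t.
have t0 : 0 < t by [].
have tr : t * K < Num.min r1 r2.
  rewrite -ltr_pdivlMr//; near: t; apply: nbhs_right_lt.
  by rewrite divr_gt0// lt_min r10.
have hB c h : 0 <= c <= t -> 0 <= h <= t ->
    `|c *: u + h *: v| <= t * (`|u| + `|v|).
  move=> /andP[c0 ct] /andP[h0 ht]; rewrite (le_trans (ler_normD _ _))//.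
  rewrite !normrZ !ger0_norm// mulrDr.
  by rewrite lerD// ler_wpM2r.
have hK c h : 0 <= c <= t -> 0 <= h <= t ->
    `|c *: u + h *: v| < Num.min r1 r2.
  move=> ct ht; rewrite (le_lt_trans (hB c h ct ht))// (le_lt_trans _ tr)//.
  rewrite ler_wpM2l// ?ltW// /K.
  by have := normr_ge0 u; lra.
have hr1 c h : 0 <= c <= t -> 0 <= h <= t -> `|c *: u + h *: v| < r1.
  by move=> ct ht; have := hK c h ct ht; rewrite lt_min => /andP[].
have hr2 c h : 0 <= c <= t -> 0 <= h <= t -> `|c *: u + h *: v| < r2.
  by move=> ct ht; have := hK c h ct ht; rewrite lt_min => /andP[].
have tt : 0 <= t <= t by rewrite lexx ltW.
have zt : 0 <= (0 : R) <= t by rewrite lexx ltW.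
pose line h (c : R) := s (y + (c *: u + h *: v)).
have dline h c : 0 <= c <= t -> 0 <= h <= t ->
    is_derive c (1 : R) (line h : R -> R) (g (y + (c *: u + h *: v))).
  move=> ct ht; have dsz := sB _ (hr2 c h ct ht).
  have E : line h = s \o (fun c : R => y + (c *: u + h *: v)) by [].
  have dl : is_diff c (fun c : R => y + (c *: u + h *: v)) ( *:%R^~ u).
    apply: is_diff_eq; rewrite -[RHS]addr0 -[in RHS](add0r ( *:%R^~ u)) -addrA.
    by [].
  have dsl : differentiable (line h) c.
    by rewrite E; apply: differentiable_comp.
  apply: DeriveDef; first exact/diff_derivable.
  rewrite deriveE// E diff_comp//= diff_val /= scale1r.
  by rewrite /g deriveE.
(* [phi t - phi 0] is the second difference. The mean value theorem in the direction [u] turns it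
   into [t] times a difference of two values of [g], so only one derivative of [g], at [y] itself,
   is ever needed. *)
pose phi c := line t c - line 0 c.
have dphi c : 0 <= c <= t -> is_derive c (1 : R) (phi : R -> R)
    (g (y + (c *: u + t *: v)) - g (y + (c *: u + 0 *: v))).
  by move=> ct; apply: is_deriveB; exact: dline.
have [||c] := @MVT_segment R phi
  (fun c => g (y + (c *: u + t *: v)) - g (y + (c *: u + 0 *: v)))
  0 t (ltW t0).
- by move=> c /[!in_itv]/= /andP[c0 ct]; apply: dphi; rewrite !ltW.
- apply: derivable_within_continuous => c /[!in_itv]/= ct.
  by have [] := dphi c ct.
rewrite in_itv /= => ct; rewrite subr0 /phi /line !(scale0r, add0r, addr0).
rewrite addrA => phiE.
set A := (X in `|X|).
(* The linear parts at the two points differ by [t *: 'd g y v] whatever the intermediate point [c]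
   is; only the two remainders of the expansion of [g] are left. *)
have {phiE} -> : A = t * ((g (y + (c *: u + t *: v)) - g y
   - 'd g y (c *: u + t *: v)) - (g (y + c *: u) - g y - 'd g y (c *: u))).
  rewrite linearD /= [in 'd g y (t *: v)]linearZ/=.
  have -> : A = (s (y + t *: u + t *: v) - s (y + t *: u) -
    (s (y + t *: v) - s y)) - t ^+ 2 * 'd g y v by rewrite /A opprD opprK addrA.
  rewrite phiE -[_ *: 'd g y v]/(t * 'd g y v).
  by move: (g _) (g _) (g _) ('d g y _) ('d g y _) => a b c' d d'; ring.
have B1 := gB _ (hr1 c t ct tt); have B2 := gB _ (hr1 c 0 ct zt).
have N1 := hB c t ct tt.
have N2 : `|c *: u| <= t * `|u|.
  move: ct => /andP[c0 ct]; rewrite normrZ ger0_norm// ler_wpM2r//.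
rewrite scale0r addr0 in B2.
rewrite normrM (gtr0_norm t0) (mulrC e) expr2 -mulrA ler_pM2l//.
rewrite (le_trans (ler_normB _ _))// (le_trans (lerD B1 B2))// -mulrDr.
rewrite mulrAC ler_pdivrMr// [t * e]mulrC -mulrA ler_pM2l//.
by rewrite (le_trans (lerD N1 N2))// -mulrDr ler_pM2l// /K; lra.
Unshelve. all: by end_near. Qed.

(** Both values, multiplied by [t ^+ 2], lie within [e / 2 * t ^+ 2] of the same second difference
    for some [t > 0]; dividing by [t ^+ 2] leaves a gap of at most [e], for every [e > 0]. *)
Lemma second_derivativeC s y u v :
  (\forall z \near y, differentiable s z) ->
  differentiable (fun z => 'D_u s z) y ->
  differentiable (fun z => 'D_v s z) y ->
  'd (fun z => 'D_u s z) y v = 'd (fun z => 'D_v s z) y u.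
Proof.
move=> ds du dv; apply/eqP; rewrite -subr_eq0 -normr_le0.
apply/ler_addgt0Pl => e e0; rewrite addr0.
have e20 : 0 < e / 2 by rewrite divr_gt0.
have Nuv := second_difference s y u v ds du _ e20.
have Nvu := second_difference s y v u ds dv _ e20.
have [t /= [t0 [Bu]]] :=
  filter_ex (filterI (nbhs_right_gt (0 : R)) (filterI Nuv Nvu)).
have t20 : 0 < t ^+ 2 by rewrite exprn_gt0.
rewrite [y + t *: v + t *: u]addrAC => Bv.
rewrite -(ler_pM2r t20) -[in X in X <= _](gtr0_norm t20) -normrM.
have := le_trans (ler_normB _ _) (lerD Bv Bu).
rewrite -mulrDl -splitr; apply: le_trans; rewrite le_eqVlt; apply/orP; left.
apply/eqP; congr (`|_|); lra.
Qed.

End SecondDerivative.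

(** * From a vanishing differential to constancy *)

(** The segment from [y0] to [y] stays in the ball, and the mean value theorem applies to [h] along
    it. *)
Lemma diff0_ball_cst {R : realType} {V : normedModType R} (h : V -> R^o)
    (y0 : V) (r : R) :
  (forall y, ball y0 r y -> differentiable h y /\ 'd h y =1 cst 0) ->
  forall y, ball y0 r y -> h y = h y0.
Proof.
move=> dh y yr.
pose line (c : R) := y0 + c *: (y - y0).
have lr (c : R) : 0 <= c <= 1 -> ball y0 r (line c).
  move=> /andP[c0 c1]; move: yr; rewrite -!ball_normE /= /line opprD addNKr.
  rewrite normrN normrZ ger0_norm//; apply: le_lt_trans.
  by rewrite distrC ler_piMl.
have dline (c : R) : 0 <= c <= 1 -> is_derive c (1 : R) (h \o line : R -> R) 0.
  move=> /lr/dh[dhc dhc0].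
  have dl : is_diff c line ( *:%R^~ (y - y0)).
    by apply: is_diff_eq; rewrite -[RHS]add0r.
  have dsl : differentiable (h \o line) c by apply: differentiable_comp.
  apply: DeriveDef; first exact/diff_derivable.
  by rewrite deriveE// diff_comp//= dhc0.
have [||c _] := @MVT_segment R (h \o line) (fun=> 0) 0 1 ler01.
- by move=> c /[!in_itv]/= /andP[c0 ct]; apply: dline; rewrite !ltW.
- apply: derivable_within_continuous => c /[!in_itv]/= ct.
  by have [] := dline c ct.
rewrite mul0r /line /= scale1r scale0r addr0 subrKC => /eqP.
by rewrite subr_eq0 => /eqP.
Qed.

(** Every preimage under [F] is open, hence the fibre through [x] is open, closed and nonempty. *)
Lemma locally_constant_connected {T : topologicalType} {A : Type} (F : T -> A) :
  connected [set: T] -> (forall x, \forall y \near x, F y = F x) ->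
  forall x y, F y = F x.
Proof.
move=> cT locF x y.
have oF (P : set A) : open (F @^-1` P).
  by rewrite openE => z Pz; apply: filterS (locF z) => w /= ->.
suff /seteqP[_ /(_ y I)] : F @^-1` [set F x] = [set: T] by [].
apply: cT.
- by exists x.
- by exists (F @^-1` [set F x]) => //; rewrite setTI.
- exists (F @^-1` [set F x]); last by rewrite setTI.
  by rewrite -[X in closed X]setCK; apply: open_closedC; exact: (oF (~` _)).
Qed.

(** * Changes of charts on the manifold and on its cotangent bundle *)

Section Charts.
Context {R : realType} {n : nat} {M : smooth_manifold R n}.
Implicit Types (c d : chart R n (mfd_space M)) (x : mfd_space M).

Lemma chart_image_nbhs c x :
  mfd_atlas c -> dom c x -> nbhs (chart_map c x) (chart_image c).
Proof.
by move=> cA cx; apply: open_nbhs_nbhs; split; [exact: mfd_image_open|exists x].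
Qed.

Lemma chart_invP c y : mfd_atlas c -> chart_image c y ->
  dom c (chart_inv c y) /\ chart_map c (chart_inv c y) = y.
Proof. by move=> cA [x cx <-]; rewrite (mfd_chartK cA). Qed.

Lemma near_chart_inv c x (A : set (mfd_space M)) :
  mfd_atlas c -> dom c x -> nbhs x A ->
  \forall y \near chart_map c x, A (chart_inv c y).
Proof.
move=> cA cx xA; have := @mfd_inv_continuous _ _ _ c cA (chart_map c x).
by apply; [exists x|rewrite (mfd_chartK cA)].
Qed.

Lemma transition_differentiable c d x : mfd_atlas c -> mfd_atlas d ->
  dom c x -> dom d x ->
  differentiable (chart_map d \o chart_inv c) (chart_map c x).
Proof.
move=> cA dA cx dx; have [+ _] := mfd_transition_smooth cA dA 1.
by apply; exists x.
Qed.

Lemma near_transition {T : Type} (f : mfd_space M -> T) c d x :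
  mfd_atlas c -> mfd_atlas d -> dom c x -> dom d x ->
  {near chart_map c x, f \o chart_inv c =1
     (f \o chart_inv d) \o (chart_map d \o chart_inv c)}.
Proof.
move=> cA dA cx dx.
have : nbhs x (dom d) := open_nbhs_nbhs (conj (mfd_dom_open dA) dx).
move=> /(near_chart_inv _ _ _ cA cx); apply: filterS => y /= dy.
by rewrite (mfd_chartK dA).
Qed.

Lemma diff_transition {W : normedModType R} (f : mfd_space M -> W) c d x :
  mfd_atlas c -> mfd_atlas d -> dom c x -> dom d x ->
  differentiable (f \o chart_inv d) (chart_map d x) ->
  differentiable (f \o chart_inv c) (chart_map c x) /\
  'd (f \o chart_inv c) (chart_map c x) =1
    'd (f \o chart_inv d) (chart_map d x) \o
    'd (chart_map d \o chart_inv c) (chart_map c x).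
Proof.
move=> cA dA cx dx df.
have dt := transition_differentiable _ _ _ cA dA cx dx.
have Et : (chart_map d \o chart_inv c) (chart_map c x) = chart_map d x.
  by rewrite /= (mfd_chartK cA).
rewrite -Et in df.
have dft := differentiable_comp dt df.
have Ef : {near chart_map c x,
    (f \o chart_inv d) \o (chart_map d \o chart_inv c) =1 f \o chart_inv c}.
  apply: filterS (near_transition f c d x cA dA cx dx) => y.
  exact: esym.
have [dfc E] := near_eq_diff _ _ _ Ef dft.
split; first exact: dfc.
have D := diff_comp dt df.
by move=> u; rewrite (congr1 (@^~ u) E) (congr1 (@^~ u) D) Et.
Qed.

(** By the chain rule, the rows of the product are the images of the basis vectors under the
    differential of [chart_map d \o chart_inv d], which is the identity near [chart_map d x]. *)
Lemma jacobian_transitionK c d x :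
  mfd_atlas c -> mfd_atlas d -> dom c x -> dom d x ->
  jacobian (chart_map c \o chart_inv d) (chart_map d x) *m
  jacobian (chart_map d \o chart_inv c) (chart_map c x) = 1%:M.
Proof.
move=> cA dA cx dx; apply/row_matrixP => i.
have dcd := transition_differentiable c d x cA dA cx dx.
have ddc := transition_differentiable d c x dA cA dx cx.
have [_ E] := diff_transition (chart_map d) d c x dA cA dx cx dcd.
rewrite row1 rowE mulmxA.
rewrite -(deriveEjacobian _ ddc) (deriveE _ ddc).
rewrite -(deriveEjacobian _ dcd) (deriveE _ dcd).
rewrite -[LHS]E.
have Ed : {near chart_map d x, id =1 chart_map d \o chart_inv d}.
  apply: filterS (chart_image_nbhs d x dA dx) => y.
  by move=> /(chart_invP _ _ dA)[_ /esym].
have [_ D] := near_eq_diff _ _ _ Ed (ex_diff (f := id)).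
by rewrite (congr1 (@^~ _) D) diff_val.
Qed.

Definition gradient (s : 'rV[R]_n -> R^o) (y : 'rV[R]_n) : 'rV[R]_n :=
  \row_j 'D_(delta_mx 0 j) s y.

(** The transposed Jacobian in [cotangent_chart] is exactly the chain rule for [S \o chart_inv c].
    The chart [c] is arbitrary because points near a given one store their covectors in charts of
    their own, while differentiating the section requires one fixed chart. *)
Lemma cotangent_chart_d_section (S : M -> R) c x :
  smooth_function S -> mfd_atlas c -> dom c x ->
  chart_map (cotangent_chart (c : chart R n M)) (d_section S x) =
  row_mx (chart_map c x) (gradient (S \o chart_inv c) (chart_map c x)).
Proof.
move=> Ss cA cx; rewrite /=; congr row_mx.
set d := mfd_chart_at x.
have dA : mfd_atlas d := mfd_chart_at_atlas x.
have dx : dom d x := mfd_chart_at_dom x.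
have dS : differentiable (S \o chart_inv d : _ -> R^o) (chart_map d x).
  by have [+ _] := Ss d dA 1; apply; exists x.
have [dSc E] := diff_transition (S : _ -> R^o) _ _ _ cA dA cx dx dS.
have dt := transition_differentiable c d x cA dA cx dx.
apply/rowP => i; rewrite [RHS]mxE (deriveE _ dSc) (E _) [RHS]/=.
rewrite -(deriveE _ dt) (deriveEjacobian _ dt) -rowE.
rewrite [X in 'd _ _ X]row_sum_delta linear_sum mxE; apply: eq_bigr => j _.
by rewrite linearZ !mxE mulrC.
Qed.

Lemma cotangent_chartK c (z : cotangent_bundle M) :
  mfd_atlas c -> dom c z.1 ->
  chart_inv (cotangent_chart (c : chart R n M))
    (chart_map (cotangent_chart (c : chart R n M)) z) = z.
Proof.
case: z => x p cA /= cx; rewrite row_mxKl row_mxKr (mfd_chartK cA)// -mulmxA.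
rewrite -trmx_mul jacobian_transitionK ?trmx1 ?mulmx1//.
  exact: mfd_chart_at_atlas.
exact: mfd_chart_at_dom.
Qed.

(** In the induced charts the projection is [lsubmx] near the point, a linear map and so its own
    differential. *)
Lemma tangent_cotangent_proj x (p a b : 'rV[R]_n) :
  tangent_map (@cotangent_proj R n M) ((x, p), row_mx a b) = (x, a).
Proof.
have cA : mfd_atlas (mfd_chart_at x) := mfd_chart_at_atlas x.
have cx : dom (mfd_chart_at x) x := mfd_chart_at_dom x.
rewrite /tangent_map; congr pair; set z := chart_map _ _.
have Ez : lsubmx z = chart_map (mfd_chart_at x) x by rewrite row_mxKl.
have dl : differentiable (lsubmx : 'rV[R]_(n + n) -> 'rV[R]_n) z.
  exact: differentiable_lsubmx.
have Ef : {near z, lsubmx =1 chart_map (mfd_chart_at x) \o @cotangent_proj R n M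
    \o chart_inv (cotangent_chart (mfd_chart_at x : chart R n M))}.
  have := chart_image_nbhs _ x cA cx; rewrite -Ez.
  move=> /(differentiable_continuous dl) zc.
  have {zc} : \forall y \near z, chart_image (mfd_chart_at x) (lsubmx y) := zc.
  apply: filterS => y /(chart_invP _ _ cA)[_].
  exact: esym.
have [_ E] := near_eq_diff _ _ _ Ef dl.
rewrite (congr1 (@^~ _) E) diff_lin; last exact: continuous_lsubmx.
exact: row_mxKl.
Qed.

End Charts.

(** * Graphs, gradients and Hessians in coordinates *)

Lemma diff_graph {R : realFieldType} {m n : nat} (g : 'rV[R]_m -> 'rV[R]_n)
    (y : 'rV[R]_m) :
  differentiable g y ->
  differentiable (fun z => row_mx z (g z)) y /\
  'd (fun z => row_mx z (g z)) y =1 fun u => row_mx u ('d g y u).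
Proof.
move=> dg.
have El j : (fun z => row_mx z (g z) 0 (lshift n j) : R^o) =
    (fun z : 'rV[R]_m => z 0 j : R^o).
  by apply/funext => z; rewrite row_mxEl.
have Er j : (fun z => row_mx z (g z) 0 (rshift m j) : R^o) =
    (fun z => g z 0 j : R^o).
  by apply/funext => z; rewrite row_mxEr.
have dG : differentiable (fun z => row_mx z (g z)) y.
  apply: differentiable_rV => k; case: (split_ordP k) => j ->.
    by rewrite El; exact: differentiable_coord.
  by rewrite Er; exact: (differentiable_comp dg (differentiable_coord _ _ _)).
split; first exact: dG.
move=> u; rewrite (diff_rV _ _ _ dG); apply/rowP => k.
rewrite mxE; case: (split_ordP k) => j ->.
  have did : differentiable (id : 'rV[R]_m -> 'rV[R]_m) y by [].
  rewrite El row_mxEl; have := diff_rV _ _ u did.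
  rewrite diff_val => Eu.
  by rewrite [RHS](congr1 (fun w : 'rV[R]_m => w 0 j) Eu) mxE.
by rewrite Er row_mxEr (diff_rV _ _ _ dg) mxE.
Qed.

Section Hessian.
Context {R : realType} {n : nat}.
Implicit Types (s : 'rV[R]_n -> R^o) (y : 'rV[R]_n).

(** The row index is the direction of the second differentiation, so that the matrix acts on row
    vectors from the right as the differential of the gradient. *)
Definition hessian s y : 'M[R]_n :=
  \matrix_(i, j) 'd (fun z => 'D_(delta_mx 0 j) s z) y (delta_mx 0 i).

Lemma tr_hessian s y (U : set 'rV[R]_n) : nbhs y U -> smooth_on U s ->
  (hessian s y)^T = hessian s y.
Proof.
move=> yU ss; have [ds _] := ss 1; have [_ dds] := ss 2.
apply/matrixP => i j; rewrite !mxE; apply: second_derivativeC.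
- exact: filterS yU.
- by have [+ _] := dds (delta_mx 0 i); apply; exact: nbhs_singleton.
- by have [+ _] := dds (delta_mx 0 j); apply; exact: nbhs_singleton.
Qed.

Lemma diff_gradient s y (U : set 'rV[R]_n) : U y -> smooth_on U s ->
  differentiable (gradient s) y /\
  'd (gradient s) y =1 fun u => u *m hessian s y.
Proof.
move=> yU ss; have [_ dds] := ss 2.
have dj j : differentiable (fun z => 'D_(delta_mx 0 j) s z : R^o) y.
  by have [+ _] := dds (delta_mx 0 j); apply.
have Ej j : (fun z => gradient s z 0 j : R^o) =
    (fun z => 'D_(delta_mx 0 j) s z : R^o).
  by apply/funext => z; rewrite mxE.
have dg : differentiable (gradient s) y.
  by apply: differentiable_rV => j; rewrite Ej.
split; first exact: dg.
move=> u; rewrite (diff_rV _ _ _ dg); apply/rowP => j.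
rewrite !mxE Ej [X in 'd _ _ X]row_sum_delta linear_sum; apply: eq_bigr => i _.
by rewrite linearZ mxE.
Qed.

End Hessian.

Lemma linear_row_mx {R : pzRingType} {V : lmodType R} {m n : nat}
    (f : {linear 'rV[R]_(m + n) -> V}) (a : 'rV[R]_m) (b : 'rV[R]_n) :
  f (row_mx a b) = \sum_i a 0 i *: f (delta_mx 0 (lshift n i)) +
                   \sum_j b 0 j *: f (delta_mx 0 (rshift m j)).
Proof.
rewrite [X in f X]row_sum_delta linear_sum big_split_ord /=.
by congr (_ + _); apply: eq_bigr => k _; rewrite linearZ ?row_mxEl ?row_mxEr.
Qed.

(** * Compatibility at a point as a vanishing differential *)

Section Compatibility.
Context {R : realType} {n : nat} {M : smooth_manifold R n}.
Context {Xi : cotangent_bundle M -> R} (Xi_smooth : smooth_function Xi).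
Context {S : M -> R} (S_smooth : smooth_function S).

(** Factors the restriction of [Xi] to the section through a Darboux chart and the graph of the
    gradient, so that the chain rule applies; the chart and its inverse cancel by
    [cotangent_chartK]. *)
Lemma near_restriction {c : chart R n (mfd_space M)} {x : mfd_space M} :
  mfd_atlas c -> dom c x ->
  {near chart_map c x,
    (Xi \o chart_inv (cotangent_chart (c : chart R n M))) \o
      (fun y => row_mx y (gradient (S \o chart_inv c) y)) =1
    (Xi \o d_section S) \o chart_inv c}.
Proof.
move=> cA cx; apply: filterS (chart_image_nbhs c x cA cx) => y.
move=> /(chart_invP _ _ cA)[cy Ey].
have := cotangent_chartK c (d_section S (chart_inv c y)) cA cy.
rewrite (cotangent_chart_d_section _ _ _ S_smooth cA cy) Ey => /= Ez.
by rewrite -[RHS](congr1 Xi Ez).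
Qed.

Lemma diff_restriction {x : mfd_space M} (c := mfd_chart_at x)
    (C := cotangent_chart (c : chart R n M))
    (dXi := 'd (Xi \o chart_inv C : _ -> R^o) (chart_map C (d_section S x)))
    (H := hessian (S \o chart_inv c) (chart_map c x)) :
  differentiable ((Xi \o d_section S) \o chart_inv c : _ -> R^o)
    (chart_map c x) /\
  'd ((Xi \o d_section S) \o chart_inv c : _ -> R^o) (chart_map c x) =1
    fun u => dXi (row_mx u (u *m H)).
Proof.
have cA : mfd_atlas c := mfd_chart_at_atlas x.
have cx : dom c x := mfd_chart_at_dom x.
have [dg Eg] := diff_gradient _ _ _
  (nbhs_singleton (chart_image_nbhs _ _ cA cx)) (S_smooth c cA).
have [dG EG] := diff_graph _ _ dg.
have zE := cotangent_chart_d_section S c x S_smooth cA cx.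
have dX : differentiable (Xi \o chart_inv C : _ -> R^o)
    (chart_map C (d_section S x)).
  have CA : atlas (c := cotangent_bundle M) C by exists c.
  by have [+ _] := Xi_smooth C CA 1; apply; exists (d_section S x).
rewrite /dXi /C zE in dX *.
have dXG := differentiable_comp dG dX.
have [dF EF] := near_eq_diff _ _ _ (near_restriction cA cx) dXG.
split; first exact: dF.
move=> u; rewrite (congr1 (@^~ u) EF) (congr1 (@^~ u) (diff_comp dG dX)).
by rewrite [LHS]/= EG Eg.
Qed.

Lemma tangent_d_section {x : mfd_space M} (u : 'rV[R]_n) (c := mfd_chart_at x) :
  tangent_map (d_section S) (x, u) =
  (d_section S x,
   row_mx u (u *m hessian (S \o chart_inv c) (chart_map c x))).
Proof.
have cA : mfd_atlas c := mfd_chart_at_atlas x.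
have cx : dom c x := mfd_chart_at_dom x.
have [dg Eg] := diff_gradient _ _ _
  (nbhs_singleton (chart_image_nbhs _ _ cA cx)) (S_smooth c cA).
have [dG EG] := diff_graph _ _ dg.
have Ef : {near chart_map c x,
    (fun y => row_mx y (gradient (S \o chart_inv c) y)) =1
    chart_map (cotangent_chart (c : chart R n M)) \o d_section S
      \o chart_inv c}.
  apply: filterS (chart_image_nbhs c x cA cx) => y.
  move=> /(chart_invP _ _ cA)[cy Ey].
  have := cotangent_chart_d_section S c _ S_smooth cA cy.
  rewrite Ey; exact: esym.
have [_ E] := near_eq_diff _ _ _ Ef dG.
by rewrite /tangent_map (congr1 (@^~ _) E) EG Eg.
Qed.

Lemma compatible_at {X_Xi} (x : mfd_space M) (c := mfd_chart_at x) :
  hamiltonian_vector_field Xi X_Xi ->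
  tangent_map (d_section S) (projected_vector_field S X_Xi x) =
    X_Xi (d_section S x) <->
  'd ((Xi \o d_section S) \o chart_inv c : _ -> R^o) (chart_map c x) =1 cst 0.
Proof.
move=> /hamiltonian_vector_fieldP VE.
have [_ dE] := diff_restriction (x := x).
have cA : mfd_atlas c := mfd_chart_at_atlas x.
have cx : dom c x := mfd_chart_at_dom x.
have Hs := tr_hessian _ _ _ (chart_image_nbhs _ _ cA cx) (S_smooth c cA).
pose C := cotangent_chart (c : chart R n M).
pose f := 'd (Xi \o chart_inv C : _ -> R^o) (chart_map C (d_section S x)).
pose a := \row_j f (delta_mx 0 (rshift n j)).
pose b := \row_j f (delta_mx 0 (lshift n j)).
have Vx : X_Xi (d_section S x) = (d_section S x, row_mx a (- b)).
  exact: VE.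
have -> : projected_vector_field S X_Xi x = (x, a).
  by rewrite -[LHS]/(tangent_map _ (X_Xi _)) Vx tangent_cotangent_proj.
rewrite Vx tangent_d_section.
set H := hessian _ _ in Hs dE *.
(* The chain rule produces [H *m a^T], whereas the tangent map of the section produces [a *m H].
   Symmetry of [H] makes one the transpose of the other. *)
have EF u : 'd ((Xi \o d_section S) \o chart_inv c : _ -> R^o)
    (chart_map c x) u = (u *m (b + a *m H)^T) 0 0.
  have -> : (b + a *m H)^T = b^T + H *m a^T by rewrite linearD /= trmx_mul Hs.
  rewrite dE linear_row_mx mulmxDr mulmxA mxE.
  by congr (_ + _); rewrite [RHS]mxE; apply: eq_bigr => j _; rewrite !mxE.
split=> [[/eq_row_mx[_ E]] u|E].
  by rewrite EF E addrN trmx0 mulmx0 mxE.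
congr (_, row_mx _ _); apply/eqP; rewrite -addr_eq0 addrC; apply/eqP/rowP => j.
have := E (delta_mx 0 j); rewrite EF -rowE !mxE => /= E0.
exact: E0.
Qed.

(** Compatibility is tested at each point in that point's own chart; this moves the result to a
    fixed chart, as constancy on a whole ball requires. *)
Lemma diff_restriction0 (c : chart R n (mfd_space M)) (x : mfd_space M)
   (F := Xi \o d_section S) (d := mfd_chart_at x) :
  mfd_atlas c -> dom c x ->
  'd (F \o chart_inv d : _ -> R^o) (chart_map d x) =1 cst 0 ->
  differentiable (F \o chart_inv c : _ -> R^o) (chart_map c x) /\
  'd (F \o chart_inv c : _ -> R^o) (chart_map c x) =1 cst 0.
Proof.
move=> cA cx dF0.
have [dF _] := diff_restriction (x := x).
have dA : mfd_atlas d := mfd_chart_at_atlas x.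
have dx : dom d x := mfd_chart_at_dom x.
have [dc E] := diff_transition (F : _ -> R^o) c d x cA dA cx dx dF.
split; first exact: dc.
by move=> u; rewrite E /= dF0.
Qed.

End Compatibility.

Theorem proposition3p1 (R : realType) (n : nat) (M : smooth_manifold R n)
    (M_connected : connected [set: mfd_space M])
    (Xi : cotangent_bundle M -> R) (Xi_dissip : dissipation_potential Xi)
    (S : M -> R) (S_smooth : smooth_function S)
    (X_Xi : cotangent_bundle M -> tangent_bundle (cotangent_bundle M))
    (X_Xi_ham : hamiltonian_vector_field Xi X_Xi) :
  tangent_map (d_section S) \o projected_vector_field S X_Xi
    = X_Xi \o d_section S
  <->
  exists eps : R, forall x : M, Xi (d_section S x) = eps.
Proof.
have [Xi_smooth _ _ _] := Xi_dissip.
have compat x := compatible_at Xi_smooth S_smooth x X_Xi_ham.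
split=> [E|[eps E]]; last first.
  apply/funext => x; apply/compat => u.
  have -> : Xi \o d_section S = cst eps by apply/funext.
  by rewrite (congr1 (@^~ u) (diff_cst eps _)).
have dF0 x := (compat x).1 (congr1 (@^~ x) E).
(* The constant is the value at a chosen point; if the manifold is empty, any constant will do. *)
have [[x0]|M0] := pselect (exists x : mfd_space M, True); last first.
  by exists 0 => x; case: M0; exists x.
move=> _; exists (Xi (d_section S x0)) => x.
apply: (locally_constant_connected
  (fun x : mfd_space M => Xi (d_section S x)) M_connected).
move=> {}x; set c := mfd_chart_at x.
have cA : mfd_atlas c := mfd_chart_at_atlas x.
have cx : dom c x := mfd_chart_at_dom x.
have /nbhs_ballP[r r0 rc] := chart_image_nbhs c x cA cx.
(* The ball lies in the image of [c], so each of its points comes from a point of [dom c] where the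
   differential vanishes. *)
have Fc : forall y, ball (chart_map c x) r y ->
    (Xi \o d_section S \o chart_inv c) y =
    (Xi \o d_section S \o chart_inv c) (chart_map c x).
  apply: diff0_ball_cst => y /rc[z cz <-].
  exact: diff_restriction0.
(* Continuity of the chart pulls the ball back to a neighbourhood of [x], which gives local
   constancy on the manifold. *)
have xr : \forall y \near x, ball (chart_map c x) r (chart_map c y) :=
  mfd_map_continuous cA cx (nbhsx_ballx _ _ r0).
have xc : nbhs x (dom c) := open_nbhs_nbhs (conj (mfd_dom_open cA) cx).
apply: filterS2 xc xr => y cy /Fc /=.
by rewrite (mfd_chartK cA cy) (mfd_chartK cA cx).
Qed.
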